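(* If a discrete group $\mathrm G$ is generated by a set $\mathfrak u$, and if $\mathrm C^*(\mathrm G)$ is a primitive C$^*$-algebra, then the embedding $\iota_e:\mathcal S(\mathfrak u)\rightarrow\mathrm C^*(\mathrm G)$ is pure in the cone $\mathcal{CP}(\mathcal S(\mathfrak u),\mathrm C^*(\mathrm G))$.
   Context: $\mathrm C^*(\mathrm G)$ is the full group C$^*$-algebra of the discrete group $\mathrm G$, in which each element of $\mathrm G$ is regarded as a unitary. For a generating set $\mathfrak u$ of $\mathrm G$ (not necessarily finite), $\mathcal S(\mathfrak u)=\mathrm{Span}\{1,u,u^*\mid u\in\mathfrak u\}\subset \mathrm C^*(\mathrm G)$, an operator system (unital selfadjoint subspace) in $\mathrm C^*(\mathrm G)$; $\iota_e$ is the inclusion map (and $(\mathrm C^*(\mathrm G),\iota_e)$ is the C$^*$-envelope of $\mathcal S(\mathfrak u)$). A C$^*$-algebra is primitive if it has a faithful irreducible representation on a Hilbert space. For operator systems $\mathcal R,\mathcal T$, $\mathcal{CP}(\mathcal R,\mathcal T)$ is the convex cone of completely positive linear maps $\mathcal R\to\mathcal T$; $\phi$ is pure in this cone if, whenever $\vartheta,\omega\in\mathcal{CP}(\mathcal R,\mathcal T)$ satisfy $\vartheta+\omega=\phi$, there is $s\in[0,1]$ with $\vartheta=s\phi$ and $\omega=(1-s)\phi$. *)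

(* Defs.v *)
From HB Require Import structures.
From mathcomp Require Import all_boot all_order all_algebra.
From mathcomp Require Import complex.
From mathcomp Require Import all_classical all_reals all_analysis.
Set Implicit Arguments.
Unset Strict Implicit.
Unset Printing Implicit Defensive.
Import Order.TTheory GRing.Theory Num.Theory.
Import numFieldNormedType.Exports.
Local Open Scope classical_set_scope.
Local Open Scope complex_scope.
Local Open Scope ring_scope.

(* Complex scalars are R[i] with R : realType.  The norm `|x| of a Hilbert space
   vector is an element of R[i]; the norm cnorm of a C*-algebra is R-valued. *)

HB.mixin Record CompleteNormedModule_isHilbert (R : realType) H
    of CompleteNormedModule R[i] H := {
  inner : H -> H -> R[i];
  inner_linearl : forall (a : R[i]) (x y z : H),
    inner (a *: x + y) z = a * inner x z + inner y z;
  innerC : forall x y : H, inner y x = (inner x y)^*;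
  inner_norm : forall x : H, inner x x = `|x| ^+ 2
}.

#[short(type="hilbertType")]
HB.structure Definition Hilbert (R : realType) :=
  {H of CompleteNormedModule R[i] H & CompleteNormedModule_isHilbert R H}.

(* MathComp has no join of rings with normed modules over a field other than
   the ring itself, so the norm and its completeness are part of the mixin. *)
HB.mixin Record isCStar (R : realType) A of GRing.Algebra R[i] A := {
  star : A -> A;
  starK : involutive star;
  star_semilinear : forall (a : R[i]) (x y : A),
    star (a *: x + y) = a^* *: star x + star y;
  starM : forall x y : A, star (x * y) = star y * star x;
  cnorm : A -> R;
  cnorm_eq0 : forall x : A, cnorm x = 0 -> x = 0;
  ler_cnormD : forall x y : A, cnorm (x + y) <= cnorm x + cnorm y;
  cnormZ : forall (a : R[i]) (x : A), (cnorm (a *: x))%:C = `|a| * (cnorm x)%:C;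
  ler_cnormM : forall x y : A, cnorm (x * y) <= cnorm x * cnorm y;
  cnorm_starM : forall x : A, cnorm (star x * x) = cnorm x ^+ 2;
  cnorm_complete : forall u : nat -> A,
    (forall e : R, 0 < e -> exists N : nat, forall m n : nat,
       (N <= m)%N -> (N <= n)%N -> cnorm (u m - u n) < e) ->
    exists l : A, forall e : R, 0 < e -> exists N : nat, forall n : nat,
       (N <= n)%N -> cnorm (u n - l) < e
}.

(* Unital, nonzero C*-algebras. *)
#[short(type="cstarType")]
HB.structure Definition CStar (R : realType) :=
  {A of GRing.Algebra R[i] A & isCStar R A}.

Definition unitary (R : realType) (A : cstarType R) (x : A) : Prop :=
  star x * x = 1 /\ x * star x = 1.

Record cstar_rep (R : realType) (A : cstarType R) (H : hilbertType R) := CstarRep {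
  rep_op :> A -> {linear H -> H};
  rep_continuous : forall a, continuous (rep_op a);
  rep_linear : forall (c : R[i]) (a b : A) (x : H),
    rep_op (c *: a + b) x = c *: rep_op a x + rep_op b x;
  rep1 : forall x, rep_op 1 x = x;
  repM : forall a b x, rep_op (a * b) x = rep_op a (rep_op b x);
  rep_star : forall a x y, inner (rep_op a x) y = inner x (rep_op (star a) y)
}.

Definition faithful (R : realType) (A : cstarType R) (H : hilbertType R)
    (pi : cstar_rep A H) : Prop :=
  forall a, (forall x, pi a x = 0) -> a = 0.

Definition irreducible (R : realType) (A : cstarType R) (H : hilbertType R)
    (pi : cstar_rep A H) : Prop :=
  (exists x : H, x != 0) /\
  forall V : set H,
    closed V -> V 0 ->
    (forall (c : R[i]) x y, V x -> V y -> V (c *: x + y)) ->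
    (forall a x, V x -> V (pi a x)) ->
    V = [set 0] \/ V = setT.

Definition primitive (R : realType) (A : cstarType R) : Prop :=
  exists (H : hilbertType R) (pi : cstar_rep A H), faithful pi /\ irreducible pi.

(* A homomorphism of G into invertible isometries of H. *)
Record unitary_rep (R : realType) (G : groupType) (H : hilbertType R) := UnitaryRep {
  urep_op :> G -> {linear H -> H};
  urep1 : forall x, urep_op 1%g x = x;
  urepM : forall g h x, urep_op (g * h)%g x = urep_op g (urep_op h x);
  urep_inner : forall g x y, inner (urep_op g x) (urep_op g y) = inner x y
}.

(* A list s : seq (R[i] * G) stands for the element
   \sum_(p <- s) p.1 p.2 of the group algebra; its maximal C*-norm is the
   supremum of the operator norms of its images under the unitary
   representations of G. *)
Definition max_norm (R : realType) (G : groupType) (s : seq (R[i] * G)) : R :=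
  sup [set r : R | exists (H : hilbertType R) (pi : unitary_rep G H) (x : H),
         `|x| <= 1 /\ r%:C = `|\sum_(p <- s) p.1 *: pi p.2 x| ].

(* (A, d) is the completion of the group *-algebra of G in the maximal C*-norm,
   which determines it up to isomorphism; d g is the unitary g. *)
Record is_full_group_cstar (R : realType) (G : groupType) (A : cstarType R)
    (d : G -> A) : Prop := {
  fgc_unitary : forall g, unitary (d g);
  fgc_one : d 1%g = 1;
  fgc_mul : forall g h, d (g * h)%g = d g * d h;
  fgc_norm : forall s : seq (R[i] * G),
    cnorm (\sum_(p <- s) p.1 *: d p.2) = max_norm s;
  fgc_dense : forall (a : A) (e : R), 0 < e -> exists s : seq (R[i] * G),
    cnorm (a - \sum_(p <- s) p.1 *: d p.2) < e
}.

Definition generates (G : groupType) (U : set G) : Prop :=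
  forall K : {pred G}, group_closed K -> (forall g, U g -> g \in K) ->
  forall g, g \in K.

HB.mixin Record isOperatorSystem (R : realType) (A : cstarType R) (S : {pred A}) := {
  opsys1 : 1 \in S;
  opsys_star : forall x, x \in S -> star x \in S
}.

#[short(type="operatorSystem")]
HB.structure Definition OperatorSystem (R : realType) (A : cstarType R) :=
  {S of @GRing.SubmodClosed R[i] A S & isOperatorSystem R A S}.

Record opsys_sort (R : realType) (A : cstarType R) (S : operatorSystem A) :=
  OpsysElt { opsys_val : A; _ : opsys_val \in S }.

Section OpsysLmodule.
Variables (R : realType) (A : cstarType R) (S : operatorSystem A).
HB.instance Definition _ := [isSub for @opsys_val R A S].
HB.instance Definition _ := [Choice of opsys_sort S by <:].
HB.instance Definition _ := [SubChoice_isSubLmodule of opsys_sort S by <:].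

Definition opsys_incl : {linear opsys_sort S -> A} := val.
End OpsysLmodule.

(* Positivity in the C*-algebra M_n(A). *)
Definition mx_positive (R : realType) (A : cstarType R) (n : nat)
    (X : 'M[A]_n) : Prop :=
  exists Y : 'M[A]_n, X = (map_mx star Y)^T *m Y.

Definition completely_positive (R : realType) (A B : cstarType R)
    (S : operatorSystem A) (phi : {linear opsys_sort S -> B}) : Prop :=
  forall (n : nat) (X : 'M[opsys_sort S]_n),
    mx_positive (map_mx (opsys_incl S) X) -> mx_positive (map_mx phi X).

Definition pure_cp (R : realType) (A B : cstarType R) (S : operatorSystem A)
    (phi : {linear opsys_sort S -> B}) : Prop :=
  completely_positive phi /\
  forall theta omega : {linear opsys_sort S -> B},
    completely_positive theta -> completely_positive omega ->
    (forall x, theta x + omega x = phi x) ->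
    exists s : R, [/\ 0 <= s <= 1,
      forall x, theta x = s%:C *: phi x &
      forall x, omega x = (1 - s)%:C *: phi x].

Section GenOpsys.
Variables (R : realType) (G : groupType) (A : cstarType R).
Variables (d : G -> A) (U : set G).

(* The spanning set 1, u, u^* of the operator system S(U), u being read as d u. *)
Definition gen_elts : set A :=
  [set 1] `|` (d @` U) `|` [set star (d u) | u in U].

Definition gen_opsys : {pred A} :=
  [pred x | `[< exists s : seq (R[i] * A),
     (forall p, p \in s -> gen_elts p.2) /\ x = \sum_(p <- s) p.1 *: p.2 >]].

Lemma gen_opsys_submod_closed : submod_closed gen_opsys.
Proof.
split; first by apply/asboolP; exists [::]; rewrite big_nil.
move=> c x y /asboolP[s [hs ->]] /asboolP[t [ht ->]]; apply/asboolP.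
exists ([seq (c * p.1, p.2) | p <- s] ++ t); split.
  move=> p; rewrite mem_cat => /orP[/mapP[q /hs hq -> //]|]; exact: ht.
rewrite big_cat /= big_map scaler_sumr; congr (_ + _).
by apply: eq_bigr => p _; rewrite scalerA.
Qed.

HB.instance Definition _ :=
  GRing.isSubmodClosed.Build R[i] A gen_opsys gen_opsys_submod_closed.

Lemma gen_opsys1 : 1 \in gen_opsys.
Proof.
apply/asboolP; exists [:: (1, 1)]; rewrite big_seq1 scale1r; split=> // p.
by rewrite inE => /eqP ->; left; left.
Qed.

Lemma star1 : star 1 = 1 :> A.
Proof. by rewrite -[LHS]mulr1 -{2}[1 : A]starK -starM mulr1 starK. Qed.

Lemma gen_elts_star x : gen_elts x -> gen_elts (star x).
Proof.
move=> [[->|[u Uu <-]]|[u Uu <-]].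
- by left; left; rewrite star1.
- by right; exists u.
- by left; right; exists u => //; rewrite starK.
Qed.

Lemma star0 : star 0 = 0 :> A.
Proof.
have := star_semilinear 1 (0 : A) 0.
rewrite rmorph1 !scale1r addr0 => /(congr1 (fun z => z - star 0)).
by rewrite addrK subrr.
Qed.

Lemma gen_opsys_star x : x \in gen_opsys -> star x \in gen_opsys.
Proof.
move=> /asboolP[s [hs ->]]; apply/asboolP.
exists [seq (p.1^*, star p.2) | p <- s]; split.
  by move=> p /mapP[q /hs hq ->]; apply: gen_elts_star.
rewrite big_map /=; elim: s {hs} => [|p s IH]; first by rewrite !big_nil star0.
by rewrite !big_cons star_semilinear IH.
Qed.

HB.instance Definition _ :=
  isOperatorSystem.Build R A gen_opsys gen_opsys1 gen_opsys_star.
End GenOpsys.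

(* Main.v *)
(* Write theta + omega = iota and a := theta 1. For u in the generating set, the
   positive matrix [[1, u], [u^*, 1]] kills the vector (-u, 1), hence so do its
   images under theta and omega, which are positive with sum this matrix. This
   gives theta u = a u = u a, so that a commutes with the generators and thus
   with all of C*(G). In a primitive C*-algebra a selfadjoint central element is
   a scalar, and theta = a iota follows on the span of 1, u, u^*.

   The triviality of the center uses only square roots. After a shift and a
   scaling a becomes a central selfadjoint contraction B on an irreducible
   Hilbert space, with <B x, x> = 0 for some x != 0. Put C := sqrt (B^2). The
   closed invariant subspace ker (C - B) is either 0, and then C = - B because
   (C - B)(C + B) = 0, or everything, and then C = B. Either way <C x, x> = 0;
   since 1 - C is a contraction this forces C x = 0, hence B x = 0, and ker B is
   a nonzero closed invariant subspace, so B = 0. *)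
From HB Require Import structures.
Require Import Defs.
From mathcomp Require Import all_boot all_order all_algebra.
From mathcomp Require Import complex.
From mathcomp Require Import all_classical all_reals all_analysis.
From mathcomp Require Import ring lra.
Set Implicit Arguments.
Unset Strict Implicit.
Unset Printing Implicit Defensive.
Import Order.TTheory GRing.Theory Num.Theory.
Import numFieldNormedType.Exports.
Local Open Scope classical_set_scope.
Local Open Scope complex_scope.
Local Open Scope ring_scope.

(** * Square roots by successive approximation *)

Section SquareRoot.
Variables (R : realType) (H : completeNormedModType R[i]) (X : {linear H -> H}).

(** A fixed point [y] of the map [y |-> (X + y^2) / 2] satisfies [(1 - y)^2 = 1 - X], so iterating
    from 0 approximates [1 - sqrt (1 - X)] by polynomials in [X]. *)
Fixpoint sqrt_iter (n : nat) : {linear H -> H} :=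
  if n is m.+1 then (2^-1 : R[i]) \*: (X \+ (sqrt_iter m \o sqrt_iter m)) else \0.

(* The value of [sqrt_iter] at [X = 1]; it bounds the norms because [sqrt_iter n] is
   a polynomial in [X] with nonnegative coefficients. *)
Fixpoint sqrt_bound (n : nat) : R :=
  if n is m.+1 then (1 + sqrt_bound m ^+ 2) / 2 else 0.

Lemma sqrt_iterS n x : sqrt_iter n.+1 x = 2^-1 *: (X x + sqrt_iter n (sqrt_iter n x)).
Proof. by []. Qed.

Lemma sqrt_iter_comm (T : {linear H -> H}) n :
  (forall x, T (X x) = X (T x)) -> forall x, T (sqrt_iter n x) = sqrt_iter n (T x).
Proof.
move=> TX; elim: n => [|n IH] x; first by rewrite /= linear0.
by rewrite !sqrt_iterS linearZ linearD TX !IH.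
Qed.

Lemma sqrt_iter_commX n x : X (sqrt_iter n x) = sqrt_iter n (X x).
Proof. exact: sqrt_iter_comm. Qed.

Lemma sqrt_iter_iter_comm m n x :
  sqrt_iter m (sqrt_iter n x) = sqrt_iter n (sqrt_iter m x).
Proof. by apply: sqrt_iter_comm => y; rewrite sqrt_iter_commX. Qed.

Lemma sqrt_bound_ge0 n : 0 <= sqrt_bound n.
Proof. by case: n => //= n; rewrite divr_ge0// addr_ge0// sqr_ge0. Qed.

Lemma sqrt_bound_le1 n : sqrt_bound n <= 1.
Proof.
elim: n => [|n IH] /=; first exact: ler01.
have := sqrt_bound_ge0 n; nra.
Qed.

Lemma sqrt_bound_leS n : sqrt_bound n <= sqrt_bound n.+1.
Proof. by have /= := sqr_ge0 (1 - sqrt_bound n); nra. Qed.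

Lemma sqrt_bound_nd : {homo sqrt_bound : m n / (m <= n)%N >-> m <= n}.
Proof. by apply/nondecreasing_seqP; exact: sqrt_bound_leS. Qed.

Lemma sqrt_bound_cvg : cvgn sqrt_bound.
Proof.
apply: nondecreasing_is_cvgn; first exact: sqrt_bound_nd.
by exists 1 => _ [n _ <-]; exact: sqrt_bound_le1.
Qed.

Hypothesis X1 : forall x, `|X x| <= `|x|.

Lemma real_half (z : R) : (2^-1 : R[i]) * z%:C = (z / 2)%:C.
Proof. by rewrite rmorphM fmorphV rmorph_nat mulrC. Qed.

Lemma norm_halfZ (x : H) : `|(2^-1 : R[i]) *: x| = 2^-1 * `|x|.
Proof. by rewrite normrZ gtr0_norm// invr_gt0. Qed.

Lemma sqrt_iter_norm n x : `|sqrt_iter n x| <= (sqrt_bound n)%:C * `|x|.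
Proof.
elim: n x => [|n IH] x; first by rewrite /= normr0 mul0r.
rewrite sqrt_iterS norm_halfZ /= -real_half -mulrA ler_pM2l ?invr_gt0//.
apply: le_trans (ler_normD _ _) _; rewrite rmorphD rmorph1 mulrDl mul1r lerD//.
apply: le_trans (IH _) _; rewrite rmorphXn expr2 -mulrA.
by rewrite ler_wpM2l// lecR sqrt_bound_ge0.
Qed.

(** The iterates commute, so a difference of squares factors: the next increment is half the sum of
    two successive iterates applied to the previous increment. The increments of [sqrt_bound] obey
    the same recursion and therefore dominate. *)
Lemma sqrt_iter_distS n x :
  `|sqrt_iter n.+1 x - sqrt_iter n x| <= (sqrt_bound n.+1 - sqrt_bound n)%:C * `|x|.
Proof.
elim: n x => [|n IH] x.
  rewrite /= subr0 subr0 expr0n addr0 /= addr0 norm_halfZ -real_half rmorph1 mulr1.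
  by rewrite ler_pM2l ?invr_gt0.
have -> : sqrt_iter n.+2 x - sqrt_iter n.+1 x =
    2^-1 *: (sqrt_iter n.+1 (sqrt_iter n.+1 x - sqrt_iter n x) +
             sqrt_iter n (sqrt_iter n.+1 x - sqrt_iter n x)).
  rewrite !linearB (sqrt_iter_iter_comm n n.+1) addrA subrK.
  rewrite [sqrt_iter n.+2 x]sqrt_iterS [in X in _ - X = _]sqrt_iterS -scalerBr.
  by rewrite opprD addrACA subrr add0r.
have -> : sqrt_bound n.+2 - sqrt_bound n.+1 =
    (sqrt_bound n.+1 + sqrt_bound n) * (sqrt_bound n.+1 - sqrt_bound n) / 2.
  rewrite -[sqrt_bound n.+2]/((1 + sqrt_bound n.+1 ^+ 2) / 2).
  have : sqrt_bound n.+1 = (1 + sqrt_bound n ^+ 2) / 2 by [].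
  by move: (sqrt_bound n.+1) (sqrt_bound n) => p q ->; field.
rewrite norm_halfZ -real_half -mulrA ler_pM2l ?invr_gt0//.
apply: le_trans (ler_normD _ _) _; rewrite rmorphM rmorphD -mulrA mulrDl lerD//.
all: apply: le_trans (sqrt_iter_norm _ _) _; rewrite ler_wpM2l// ?lecR ?sqrt_bound_ge0//.
Qed.

Lemma sqrt_iter_dist n k x :
  `|sqrt_iter (n + k) x - sqrt_iter n x| <= (sqrt_bound (n + k) - sqrt_bound n)%:C * `|x|.
Proof.
elim: k => [|k IH]; first by rewrite addn0 !subrr normr0 mul0r.
rewrite addnS -(subrKA (sqrt_iter (n + k) x)) -[in leRHS](subrKA (sqrt_bound (n + k))).
apply: le_trans (ler_normD _ _) _; rewrite rmorphD mulrDl lerD//.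
exact: sqrt_iter_distS.
Qed.

Lemma sqrt_iter_cvg x : cvgn (fun n => sqrt_iter n x).
Proof.
apply/cauchy_cvgP/cauchy_exP => e e0.
have [r xr] : exists r, `|x| = r%:C by apply/complex_realP/normr_real.
have [e' ee'] : exists e', e = e'%:C by apply/complex_realP/gtr0_real.
have r0 : 0 <= r by rewrite -ler0c -xr normr_ge0.
have e'0 : 0 < e' by rewrite -ltcR -ee'.
(* Dividing by [r + 1] rather than by [r], the norm of [x], also covers [x = 0]. *)
have d0 : 0 < e' / (r + 1) by rewrite divr_gt0// ltr_wpDl.
have [N _ HN] := (@cvgrPdist_lt _ _ _ _ _ _ _).1 sqrt_bound_cvg _ d0.
exists (sqrt_iter N x); exists N => // n /= Nn.
rewrite -ball_normE /ball_/= distrC -(subnKC Nn).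
apply: le_lt_trans (sqrt_iter_dist _ _ _) _; rewrite subnKC//.
rewrite xr ee' -rmorphM ltcR.
have le1 : sqrt_bound n - sqrt_bound N <= e' / (r + 1).
  apply: le_trans (ltW (HN N (leqnn N))); apply: le_trans (ler_norm _).
  by rewrite lerB// nondecreasing_cvgn_le//; [exact: sqrt_bound_nd|exact: sqrt_bound_cvg].
apply: (@le_lt_trans _ _ (e' / (r + 1) * r)); first by rewrite ler_wpM2r.
by rewrite mulrAC ltr_pdivrMr ?ltr_wpDl// ltr_pM2l// ltrDl.
Qed.

(* [Y] is [1 - sqrt (1 - X)]. *)
Lemma one_sub_sqrt : exists Y : {linear H -> H},
  [/\ forall x, `|Y x| <= `|x|,
      forall x, X x + Y (Y x) = 2 *: Y x &
      forall T : {linear H -> H}, continuous T ->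
        (forall x, T (X x) = X (T x)) -> forall x, T (Y x) = Y (T x)].
Proof.
pose Y x := limn (fun n => sqrt_iter n x).
have YE x : (fun n => sqrt_iter n x) @ \oo --> Y x by exact: sqrt_iter_cvg.
have Ylin : linear Y.
  move=> a x y; apply/cvg_lim => //.
  have -> : (fun n => sqrt_iter n (a *: x + y)) =
      (fun n => a *: sqrt_iter n x + sqrt_iter n y).
    by apply/funext => n; rewrite linearP.
  by apply: cvgD (YE y); apply: cvgZl_tmp.
pose Z : {linear H -> H} := HB.pack Y (GRing.isLinear.Build _ _ _ _ _ Ylin).
have iter1 n x : `|sqrt_iter n x| <= `|x|.
  apply: le_trans (sqrt_iter_norm n x) _; rewrite -[leRHS]mul1r ler_wpM2r//.
  by rewrite -(rmorph1 (real_complex R)) lecR sqrt_bound_le1.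
have Y1 x : `|Y x| <= `|x|.
  apply/ler_addgt0Pr => e e0.
  have [N _ /(_ N (leqnn N)) /= HN] := (@cvgrPdist_lt _ _ _ _ _ _ _).1 (YE x) _ e0.
  rewrite -(subrK (sqrt_iter N x) (Y x)) addrC.
  by apply: le_trans (ler_normD _ _) _; rewrite lerD// ltW.
exists Z; split=> [//||]; last first.
  move=> T cT TX x; apply/esym/cvg_lim => //.
  have -> : (fun n => sqrt_iter n (T x)) = (fun n => T (sqrt_iter n x)).
    by apply/funext => n; rewrite sqrt_iter_comm.
  by apply: continuous_cvg (YE x); exact: cT.
move=> x; change (X x + Y (Y x) = 2 *: Y x).
(* Both the operator and its argument vary with [n]. Since all iterates are contractions, the error
   in the argument still tends to 0. *)
have YY : (fun n => sqrt_iter n (sqrt_iter n x)) @ \oo --> Y (Y x).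
  have -> : (fun n => sqrt_iter n (sqrt_iter n x)) =
      (fun n => sqrt_iter n (sqrt_iter n x - Y x) + sqrt_iter n (Y x)).
    by apply/funext => n; rewrite linearB subrK.
  rewrite -[X in _ --> X]add0r; apply: cvgD (YE (Y x)).
  apply/cvgr0Pnorm_lt => e e0.
  have [N _ HN] := (@cvgrPdistC_lt _ _ _ _ _ _ _).1 (YE x) _ e0.
  by exists N => // n /HN /=; apply: le_lt_trans.
(* The recursion passes to the limit; the shifted sequence has the same limit [Y x], whence the
   fixed-point equation. *)
have h : (fun n => sqrt_iter n.+1 x) @ \oo --> (2^-1 : R[i]) *: (X x + Y (Y x)).
  by apply: cvgZl_tmp; apply: cvgD YY; exact: cvg_cst.
have {2}-> : Y x = (2^-1 : R[i]) *: (X x + Y (Y x)).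
  by apply: cvg_unique h => //; move: (YE x); rewrite -cvg_shiftS.
by rewrite scalerA mulfV ?scale1r // pnatr_eq0.
Qed.
End SquareRoot.

(** * Continuous linear maps and the geometry of the inner product *)

Lemma contraction_continuous (K : numFieldType) (V W : normedModType K)
    (Y : {linear V -> W}) : (forall x, `|Y x| <= `|x|) -> continuous Y.
Proof.
move=> Y1 x; apply/cvgrPdist_lt => e e0; near=> z.
rewrite -linearB; apply: le_lt_trans (Y1 _) _.
by near: z; apply: cvgr_dist_lt => //; exact: cvg_id.
Unshelve. all: by end_near. Qed.

Lemma closed_kernel (K : numFieldType) (V W : normedModType K)
    (f : {linear V -> W}) : continuous f -> closed [set x | f x = 0].
Proof.
move=> cf; apply: (@preimage_closed _ _ f [set 0]) => [x _|]; first exact: cf.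
exact/accessible_closed_set1/hausdorff_accessible/norm_hausdorff.
Qed.

Section Inner.
Variables (R : realType) (H : hilbertType R).
Implicit Types x y z : H.

Lemma innerDl x y z : inner (x + y) z = inner x z + inner y z.
Proof. by rewrite -[x]scale1r inner_linearl !scale1r mul1r. Qed.

Lemma inner0l z : inner 0 z = 0.
Proof. by apply: (addIr (inner 0 z)); rewrite -innerDl addr0 add0r. Qed.

Lemma innerZl a x z : inner (a *: x) z = a * inner x z.
Proof. by rewrite -[a *: x]addr0 inner_linearl inner0l addr0. Qed.

Lemma innerBl x y z : inner (x - y) z = inner x z - inner y z.
Proof. by rewrite -scaleN1r innerDl innerZl mulN1r. Qed.

Lemma innerBr x y z : inner z (x - y) = inner z x - inner z y.
Proof. by rewrite [LHS]innerC innerBl rmorphB [inner z x]innerC [inner z y]innerC. Qed.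

Lemma sqr_normB x y :
  `|x - y| ^+ 2 = `|x| ^+ 2 - inner x y - inner y x + `|y| ^+ 2.
Proof. by rewrite -!inner_norm innerBl !innerBr; ring. Qed.

(** Expanding the square, [|Y x - x|^2 = |Y x|^2 - |x|^2], which is at most 0. *)
Lemma contraction_fixed (Y : {linear H -> H}) x :
  `|Y x| <= `|x| -> inner (Y x) x = `|x| ^+ 2 -> Y x = x.
Proof.
move=> Yx1 Yxx; apply/eqP; rewrite -subr_eq0 -normr_eq0 -sqrf_eq0.
rewrite eq_le exprn_ge0// andbT sqr_normB Yxx innerC Yxx.
rewrite (_ : (`|x| ^+ 2)^* = `|x| ^+ 2); last by rewrite conj_Creal ?rpredX ?normr_real.
by rewrite subrK subr_le0 lerXn2r// nnegrE.
Qed.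
End Inner.

(** * Representations, and central elements under an irreducible one *)

Section Rep.
Variables (R : realType) (A : cstarType R) (H : hilbertType R).
Variable pi : cstar_rep A H.

Lemma repD a b x : pi (a + b) x = pi a x + pi b x.
Proof. by rewrite -[a]scale1r rep_linear !scale1r. Qed.

Lemma rep0 x : pi 0 x = 0.
Proof. by apply: (addIr (pi 0 x)); rewrite -repD addr0 add0r. Qed.

Lemma repZ c a x : pi (c *: a) x = c *: pi a x.
Proof. by rewrite -[c *: a]addr0 rep_linear rep0 addr0. Qed.

Lemma repB a b x : pi (a - b) x = pi a x - pi b x.
Proof. by rewrite -scaleN1r repD repZ scaleN1r. Qed.

Lemma rep_sum (I : Type) (r : seq I) (F : I -> A) x :
  pi (\sum_(i <- r) F i) x = \sum_(i <- r) pi (F i) x.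
Proof.
by elim: r => [|i r IH]; rewrite ?big_nil ?rep0// !big_cons repD IH.
Qed.

Lemma inner_rep_starM a x : inner (pi (star a * a) x) x = `|pi a x| ^+ 2.
Proof. by rewrite repM rep_star starK inner_norm. Qed.

(** Pairing the image of the sum at [x] with [x] gives a vanishing sum of the squares
    [|pi (p i) x|^2]; faithfulness then yields [p i = 0]. *)
Lemma sum_starM_eq0 (I : finType) (p : I -> A) : faithful pi ->
  \sum_i star (p i) * p i = 0 -> forall i, p i = 0.
Proof.
move=> fpi sum0 i; apply: fpi => x; apply/eqP; rewrite -normr_eq0 -sqrf_eq0.
have : \sum_i `|pi (p i) x| ^+ 2 = 0.
  rewrite -[RHS](inner0l x) -(rep0 x) -sum0 rep_sum.
  elim: index_enum => [|j r IH]; rewrite ?big_nil ?inner0l//.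
  by rewrite !big_cons innerDl IH inner_rep_starM.
move=> /eqP; rewrite psumr_eq0; last by move=> j _; rewrite exprn_ge0.
by move=> /allP/(_ i); apply; rewrite mem_index_enum.
Qed.

Lemma inner_rep_sqr b x : star b = b -> inner (pi b (pi b x)) x = `|pi b x| ^+ 2.
Proof. by move=> bs; rewrite rep_star bs inner_norm. Qed.

Lemma central_contraction_kernel b x :
  irreducible pi -> star b = b -> (forall a, a * b = b * a) ->
  (forall y, `|pi b y| <= `|y|) -> inner (pi b x) x = 0 -> pi b x = 0.
Proof.
move=> [_ irr] bs bC b1 bxx.
(* With [X = 1 - b^2], the operator [1 - Y] is the square root [C] of [b^2]. *)
have XE y : pi (1 - b * b) y = y - pi b (pi b y) by rewrite repB rep1 repM.
have [y|Y [Y1 YY YC]] := @one_sub_sqrt R H (pi (1 - b * b)).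
  (* [X] is a contraction: [|y - b^2 y|^2 = |y|^2 - 2 |b y|^2 + |b^2 y|^2], and
     [|b^2 y| <= |b y|]. *)
  rewrite -ler_sqr ?nnegrE// XE sqr_normB [inner y _]innerC.
  rewrite inner_rep_sqr// conj_Creal ?rpredX ?normr_real// -subr_ge0.
  set m := `|pi b y| ^+ 2; set k := `|pi b (pi b y)| ^+ 2.
  have -> : `|y| ^+ 2 - (`|y| ^+ 2 - m - m + k) = m + (m - k) by ring.
  by rewrite addr_ge0 ?exprn_ge0// subr_ge0 lerXn2r// nnegrE.
have piY a y : pi a (Y y) = Y (pi a y).
  apply: YC => [|z]; first exact: rep_continuous.
  by rewrite -!repM mulrBr mulrBl mulr1 mul1r mulrA bC -mulrA bC mulrA.
have cY : continuous Y by exact: contraction_continuous.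
(* [f] is [C - b]. It commutes with every [pi a], so its kernel is invariant. *)
have [f fE] : exists f : {linear H -> H}, forall y, f y = y - Y y - pi b y.
  by exists ((idfun \- Y) \- pi b).
have kerf : [set y | f y = 0] = [set 0] \/ [set y | f y = 0] = setT.
  apply: irr.
  - apply: closed_kernel.
    have -> : f = (fun y => y - Y y - pi b y) :> (H -> H) by exact/funext.
    move=> y; apply: cvgB; last exact: rep_continuous.
    by apply: cvgB; [exact: cvg_id|exact: cY].
  - exact: linear0.
  - by move=> c y z /= fy fz; rewrite linearP fy fz scaler0 addr0.
  - move=> a y /= fy; have <- : pi a (f y) = 0 by rewrite fy linear0.
    by rewrite !fE !linearB piY -!repM bC.
have sqC y : y - Y y - Y (y - Y y) = pi b (pi b y).
  have := YY y; rewrite XE scaler_nat mulr2n linearB => e.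
  rewrite opprB -(addrA y) [- Y y + _]addrCA -opprD -e.
  by rewrite [_ + Y (Y y)]addrC opprD [Y (Y y) + _]addrA subrr add0r subKr.
have Yx : inner (x - Y x) x = 0.
  case: kerf => [V0|VT].
    (* [(C - b) (C + b) = C^2 - b^2 = 0] puts [C x + b x] in the kernel of [f]; when that kernel is
       0, [C x = - b x]. *)
    have : [set y | f y = 0] (x - Y x + pi b x).
      rewrite /= fE (linearD Y) (linearD (pi b)) opprD addrACA sqC.
      by rewrite (linearB (pi b)) piY [X in X - _]addrC subrr.
    rewrite V0 => /eqP; rewrite addr_eq0 => /eqP ->.
    by rewrite -scaleN1r innerZl bxx mulr0.
  have : [set y | f y = 0] x by rewrite VT.
  by rewrite /= fE => /eqP; rewrite subr_eq0 => /eqP ->.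
have {Yx} Yx : Y x = x.
  apply: contraction_fixed; first exact: Y1.
  apply/esym/eqP.
  by rewrite -inner_norm -subr_eq0 -innerBl Yx.
(* Now [C x = 0], so [|b x|^2] is the inner product of [C^2 x] with [x], which is 0. *)
apply/eqP; rewrite -normr_eq0 -sqrf_eq0 -inner_rep_sqr// -sqC Yx subrr.
by rewrite linear0 subrr inner0l.
Qed.
End Rep.

(** * Selfadjoint central elements and positive matrices *)

Section CStar.
Variables (R : realType) (A : cstarType R).
Implicit Types a b x y : A.

Lemma starD x y : star (x + y) = star x + star y.
Proof. by rewrite -[x]scale1r star_semilinear rmorph1 !scale1r. Qed.

Lemma starZ (c : R[i]) x : star (c *: x) = c^* *: star x.
Proof. by rewrite -[c *: x]addr0 star_semilinear star0 addr0. Qed.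

Lemma starZr (r : R) x : star (r%:C *: x) = r%:C *: star x.
Proof. by rewrite starZ conj_Creal//; apply/complex_realP; exists r. Qed.

Lemma starB x y : star (x - y) = star x - star y.
Proof. by rewrite -scaleN1r starD starZ rmorphN rmorph1 scaleN1r. Qed.

Lemma cnorm0 : cnorm (0 : A) = 0.
Proof. by apply: complexI; rewrite -(scale0r (0 : A)) cnormZ normr0 mul0r. Qed.

Lemma cnormN x : cnorm (- x) = cnorm x.
Proof. by apply: complexI; rewrite -scaleN1r cnormZ normrN1 mul1r. Qed.

Lemma cnorm_ge0 x : 0 <= cnorm x.
Proof.
have := ler_cnormD x (- x); rewrite subrr cnorm0 cnormN; lra.
Qed.

(** The scalar is the Rayleigh quotient of [a] at a nonzero vector [x]. Subtracting it leaves a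
    central [b] with [pi b x = 0]. The closed invariant kernel of [pi b] contains [x], so it is the
    whole space, and faithfulness gives [b = 0]. *)
Lemma self_adjoint_central_scalar a : primitive A -> star a = a ->
  (forall x, x * a = a * x) -> exists r : R, a = r%:C *: 1.
Proof.
move=> [H [pi [fpi irr]]] sa aC; have [[x x0] irrV] := irr.
have [q qE] : exists q : R, inner (pi a x) x = q%:C.
  by apply/complex_realP/CrealP; rewrite -innerC rep_star sa.
have [n nE] : exists n : R, `|x| = n%:C by apply/complex_realP/normr_real.
have n0 : n != 0 by apply: contra_neq x0 => n0; apply/eqP; rewrite -normr_eq0 nE n0.
exists (q / n ^+ 2); set r := q / n ^+ 2; apply/eqP; rewrite -subr_eq0.
set b := a - _; apply/eqP.
have sb : star b = b by rewrite /b starB starZr sa star1.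
have bC y : y * b = b * y.
  by rewrite /b mulrBr mulrBl aC -scalerAl -scalerAr mul1r mulr1.
have bxx : inner (pi b x) x = 0.
  rewrite /b repB repZ rep1 innerBl innerZl qE inner_norm nE -rmorphXn -rmorphM.
  by rewrite /r divfK ?subrr// expf_neq0.
(* Dividing [b] by a positive bound of [pi b] yields the contraction that
   [central_contraction_kernel] requires. *)
have [k k0 kb] : exists2 k, 0 < k & forall y : H, `|pi b y| <= k * `|y|.
  apply: pinfty_ex_gt0; apply/linear_boundedP/linear_bounded_continuous.
  exact: rep_continuous.
have [k' kE] : exists k' : R, k = k'%:C by apply/complex_realP/gtr0_real.
have kV (y : H) : k^-1 *: y = (k'^-1)%:C *: y :> H by rewrite kE fmorphV.
have bx0 : pi b x = 0.
  have : pi ((k'^-1)%:C *: b) x = 0.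
    apply: central_contraction_kernel => //.
    - by rewrite starZr sb.
    - by move=> y; rewrite -scalerAl -scalerAr bC.
    - move=> y; rewrite repZ -kV normrZ gtr0_norm ?invr_gt0//.
      by rewrite ler_pdivrMl.
    - by rewrite repZ innerZl bxx mulr0.
  by rewrite repZ -kV => /eqP; rewrite scaler_eq0 invr_eq0 gt_eqF//= => /eqP.
have : [set y | pi b y = 0] = [set 0] \/ [set y | pi b y = 0] = setT.
  apply: irrV.
  - by apply: closed_kernel; exact: rep_continuous.
  - exact: linear0.
  - by move=> c y z /= by0 bz0; rewrite linearP by0 bz0 scaler0 addr0.
  - by move=> c y /= by0; rewrite -repM -bC repM by0 linear0.
case=> [V0|VT]; last first.
  by apply: fpi => y; have : [set y | pi b y = 0] y by rewrite VT.
have : [set y | pi b y = 0] x by [].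
by rewrite V0 /= => xE; rewrite xE eqxx in x0.
Qed.

(** At a nonzero vector [x] of the representation, [r |x|^2 = |pi y x|^2]. *)
Lemma scalar_starM_ge0 (r : R) y : primitive A ->
  r%:C *: 1 = star y * y -> 0 <= r.
Proof.
move=> [H [pi [_ [[x x0] _]]]] ry.
rewrite -ler0c -(@pmulr_lge0 _ (`|x| ^+ 2)) ?exprn_gt0 ?normr_gt0//.
by rewrite -inner_norm -innerZl -(rep1 pi x) -repZ rep1 ry inner_rep_starM exprn_ge0.
Qed.

Definition adj m n (M : 'M[A]_(m, n)) : 'M[A]_(n, m) := (map_mx (@star R A) M)^T.

Lemma star_sum (I : Type) (r : seq I) (F : I -> A) :
  star (\sum_(i <- r) F i) = \sum_(i <- r) star (F i).
Proof.
by elim: r => [|i r IH]; rewrite ?big_nil ?star0// !big_cons starD IH.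
Qed.

Lemma adjM m n p (M : 'M[A]_(m, n)) (N : 'M[A]_(n, p)) :
  adj (M *m N) = adj N *m adj M.
Proof.
apply/matrixP => i j; rewrite !mxE star_sum.
by apply: eq_bigr => k _; rewrite !mxE starM.
Qed.

Lemma adjK m n (M : 'M[A]_(m, n)) : adj (adj M) = M.
Proof. by apply/matrixP => i j; rewrite !mxE starK. Qed.

Lemma adj_mulE m n (M : 'M[A]_(m, n)) i j :
  (adj M *m M) i j = \sum_k star (M k i) * M k j.
Proof. by rewrite mxE; apply: eq_bigr => k _; rewrite !mxE. Qed.

Lemma adj_mx_positive n (X : 'M[A]_n) : mx_positive X -> adj X = X.
Proof. by move=> [Y ->]; rewrite -/(adj Y) adjM adjK. Qed.

(** With [X = P^* P] and [Y = Q^* Q], the equation [v^* (X + Y) v = 0] says that the terms [p^* p],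
    for [p] an entry of [P v] or [Q v], sum to 0. Hence [P v = 0]. *)
Lemma mx_positive_addl_kernel n (X Y : 'M[A]_n) (v : 'cV[A]_n) :
  primitive A -> mx_positive X -> mx_positive Y -> (X + Y) *m v = 0 ->
  X *m v = 0.
Proof.
move=> [H [pi [fpi _]]] [P ->] [Q ->]; rewrite -/(adj P) -/(adj Q) => PQv.
pose p (i : 'I_n + 'I_n) :=
  match i with inl k => (P *m v) k ord0 | inr k => (Q *m v) k ord0 end.
have p0 : forall i, p i = 0.
  apply: (sum_starM_eq0 fpi); rewrite big_sumType /=.
  have : (adj v *m ((adj P *m P + adj Q *m Q) *m v)) ord0 ord0 = 0.
    by rewrite PQv mulmx0 mxE.
  rewrite mulmxDl mulmxDr -!mulmxA !(mulmxA (adj v)) -!adjM mxE.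
  by rewrite !adj_mulE.
have Pv : P *m v = 0 by apply/matrixP => i j; rewrite ord1 [RHS]mxE; exact: (p0 (inl i)).
by rewrite -mulmxA Pv mulmx0.
Qed.
End CStar.

(** * Completely positive summands of the inclusion at a unitary *)

Section CompletelyPositive.
Variables (R : realType) (A : cstarType R) (S : operatorSystem A).
Variables (theta omega : {linear opsys_sort S -> A}).
Hypotheses (primA : primitive A).
Hypotheses (cp_theta : completely_positive theta).
Hypotheses (cp_omega : completely_positive omega).
Hypothesis sum_incl : forall x, theta x + omega x = opsys_incl S x.
Variables (e w w' : opsys_sort S) (u : A).
Hypotheses (eE : val e = 1) (wE : val w = u) (w'E : val w' = star u).
Hypothesis uu : unitary u.

Let M : 'M[opsys_sort S]_2 := \matrix_(i, j)
  if i == j then e else if i == ord0 then w else w'.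

Let M_positive : mx_positive (map_mx (opsys_incl S) M).
Proof.
(* The factor has rows [(1, u)] and [(0, 0)]; the lower right entry of the product is
   [u^* u = 1]. *)
exists (\matrix_(i, j) if i == ord0 then if j == ord0 then 1 else u else 0).
apply/matrixP => i j; rewrite !mxE !big_ord_recl big_ord0 !mxE /=.
rewrite star0 mul0r !addr0.
by case: i j => [[|[|//]] hi] [[|[|//]] hj] //=;
  rewrite ?star1 ?mul1r ?mulr1 ?eE ?wE ?w'E ?uu.1.
Qed.

Lemma cp_unitary : [/\ u * theta e = theta e * u, theta w = theta e * u &
  theta w' = theta e * star u].
Proof.
have posT := cp_theta M_positive; have posO := cp_omega M_positive.
pose v : 'cV[A]_2 := \col_i if i == ord0 then - u else 1.
have kerv : map_mx theta M *m v = 0.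
  apply: mx_positive_addl_kernel posO _ => //; apply/matrixP => i j.
  rewrite !mxE !big_ord_recl big_ord0 !mxE !sum_incl /=.
  by case: i => [[|[|//]] hi] /=; rewrite ?eE ?wE ?w'E ?mul1r ?mulr1
    ?mulrN ?uu.1 addr0 addNr.
have sT := adj_mx_positive posT.
have se : star (theta e) = theta e.
  by move/matrixP/(_ ord0 ord0): sT; rewrite !mxE /=.
have sw : star (theta w) = theta w'.
  by move/matrixP/(_ ord_max ord0): sT; rewrite !mxE /=.
have wr : theta w = theta e * u.
  move/matrixP/(_ ord0 ord0): kerv; rewrite !mxE !big_ord_recl big_ord0 !mxE /=.
  by rewrite mulr1 addr0 mulrN addrC => /eqP; rewrite subr_eq0 => /eqP.
have w'u : theta w' * u = theta e.
  move/matrixP/(_ ord_max ord0): kerv; rewrite !mxE !big_ord_recl big_ord0 !mxE /=.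
  by rewrite mulr1 addr0 mulrN addrC => /eqP; rewrite subr_eq0 => /eqP.
(* The adjoint of [theta w' * u = theta e] is [u^* * theta w = theta e]; multiplying by [u] on the
   left uses [u u^* = 1]. *)
have wl : theta w = u * theta e.
  by rewrite -se -w'u starM -sw starK mulrA uu.2 mul1r.
by split; rewrite ?wr// -?wl// -sw wl starM se.
Qed.
End CompletelyPositive.

(** Complete positivity at size 1, applied to [1 = 1^* 1]. *)
Lemma cp_unit_positive (R : realType) (A : cstarType R) (S : operatorSystem A)
    (theta : {linear opsys_sort S -> A}) (e : opsys_sort S) :
  val e = 1 -> completely_positive theta -> exists y, theta e = star y * y.
Proof.
move=> eE cp; have [] := cp 1%N (\matrix_(_, _) e).
  exists (\matrix_(_, _) 1); apply/matrixP => i j.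
  by rewrite adj_mulE big_ord1 !mxE /= eE star1 mulr1.
move=> Y /matrixP/(_ ord0 ord0); rewrite adj_mulE big_ord1 !mxE => ->.
by exists (Y ord0 ord0).
Qed.

(** * From generators to the whole algebra, and purity *)

Lemma central_of_generators (R : realType) (G : groupType) (U : set G)
    (A : cstarType R) (d : G -> A) (a : A) :
  generates U -> is_full_group_cstar d ->
  (forall u, U u -> d u * a = a * d u) -> forall x, x * a = a * x.
Proof.
move=> genU [_ d1 dM _ dense] aU.
have ad g : d g * a = a * d g.
  (* The group elements whose unitaries commute with [a] form a subgroup containing [U]; density
     then extends commutation to all of [A]. *)
  pose K := [pred g | d g * a == a * d g].
  apply/eqP; apply: (genU K) => [|h Uh]; last by rewrite inE aU.
  split=> [|g1 g2]; rewrite !inE; first by rewrite d1 mul1r mulr1.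
  move=> /eqP ag1 /eqP ag2; apply/eqP; rewrite dM -mulrA.
  have d2V : d g2^-1%g * d g2 = 1 by rewrite -dM mulVg d1.
  have dV2 : d g2 * d g2^-1%g = 1 by rewrite -dM mulgV d1.
  suff -> : d g2^-1%g * a = a * d g2^-1%g by rewrite !mulrA ag1.
  by rewrite -[LHS]mulr1 -dV2 mulrA -(mulrA _ a) -ag2 mulrA d2V mul1r.
move=> x; apply/eqP; rewrite -subr_eq0; apply/eqP/cnorm_eq0/eqP.
rewrite eq_le cnorm_ge0 andbT; apply/ler_addgt0Pr => e e0; rewrite add0r.
(* The commutator of [x] with [a] is that of [x - y], which has two terms of norm at most
   [cnorm (x - y) * cnorm a]; adding 1 keeps the divisor positive when [a = 0]. *)
have c0 : 0 < 2 * (cnorm a + 1) by rewrite mulr_gt0// ltr_wpDl// cnorm_ge0.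
have [s] := dense x _ (divr_gt0 e0 c0); set y := \sum_(p <- s) _ => xy.
have ya : y * a = a * y.
  rewrite /y mulr_suml mulr_sumr; apply: eq_bigr => p _.
  by rewrite -scalerAl -scalerAr ad.
have -> : x * a - a * x = (x - y) * a + - (a * (x - y)).
  by rewrite mulrBl mulrBr ya opprB addrA subrK.
apply: le_trans (ler_cnormD _ _) _; rewrite cnormN.
have h1 := ler_cnormM (x - y) a; have h2 := ler_cnormM a (x - y).
have := cnorm_ge0 a; have := cnorm_ge0 (x - y).
move: xy; rewrite ltr_pdivlMr//; nra.
Qed.

Theorem theorem4p2 (R : realType) (G : groupType) (U : set G)
    (A : cstarType R) (d : G -> A) :
  generates U -> is_full_group_cstar d -> primitive A ->
  pure_cp (opsys_incl (gen_opsys d U)).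
Proof.
move=> genU fgc primA; split; first by move=> n X.
move=> theta omega cp_theta cp_omega sum_incl.
pose S : operatorSystem A := gen_opsys d U.
have memS a : gen_elts d U a -> a \in gen_opsys d U.
  move=> ga; apply/asboolP; exists [:: (1, a)]; rewrite big_seq1 scale1r.
  by split=> // p; rewrite inE => /eqP ->.
pose elt a (ga : gen_elts d U a) : opsys_sort S := OpsysElt (memS a ga).
have g1 : gen_elts d U 1 by left; left.
have gu u : U u -> gen_elts d U (d u) by move=> Uu; left; right; exists u.
have gv u : U u -> gen_elts d U (star (d u)) by move=> Uu; right; exists u.
pose e : opsys_sort S := elt 1 g1.
have cpU u (Uu : U u) := cp_unitary primA cp_theta cp_omega sum_incl
  (erefl : val e = 1) (erefl : val (elt _ (gu u Uu)) = d u)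
  (erefl : val (elt _ (gv u Uu)) = star (d u)) (fgc_unitary fgc u).
have [y yE] := cp_unit_positive (erefl : val e = 1) cp_theta.
have [z zE] := cp_unit_positive (erefl : val e = 1) cp_omega.
have [r rE] : exists r : R, theta e = r%:C *: 1.
  apply: self_adjoint_central_scalar => //.
    by rewrite yE starM starK.
  by apply: central_of_generators genU fgc _ => u Uu; have [] := cpU u Uu.
have thetaE x : theta x = r%:C *: val x.
  have gen t : gen_elts d U (val t) -> theta t = r%:C *: val t.
    case=> [[/= t1|[u Uu ut]]|[u Uu ut]].
    - by rewrite t1 -rE; congr (theta _); exact: val_inj.
    - have [_ tu _] := cpU u Uu; rewrite -ut -[d u]mul1r scalerAl -rE -tu.
      by congr (theta _); exact: val_inj.
    - have [_ _ tu] := cpU u Uu; rewrite -ut -[star _]mul1r scalerAl -rE -tu.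
      by congr (theta _); exact: val_inj.
  have /asboolP[s [gs]] : val x \in gen_opsys d U by exact: valP.
  (* Induction on the linear combination with [x] generalized: removing the head term leaves an
     element of [S], to which [theta] still applies. *)
  elim: s x gs => [|[c a] s IH] x gs xE.
    have -> : x = 0 by apply: val_inj; rewrite xE big_nil linear0.
    by rewrite !linear0.
  have ga : gen_elts d U a by apply: (gs (c, a)); rewrite inE eqxx.
  have xE' : val (x - c *: elt a ga) = \sum_(p <- s) p.1 *: p.2.
    by rewrite linearB linearZ /= xE big_cons /= scalerN addrAC subrr add0r.
  have -> : theta x = theta (x - c *: elt a ga) + c *: theta (elt a ga).
    by rewrite linearB linearZ subrK.
  rewrite (gen (elt a ga))// (IH _ _ xE'); last first.
    by move=> p ps; apply: gs; rewrite inE ps orbT.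
  by rewrite xE' xE big_cons scalerDr addrC /= !scalerA mulrC.
have omegaE x : omega x = (1 - r)%:C *: val x.
  rewrite rmorphB rmorph1 scalerBl scale1r -thetaE.
  by rewrite -[val x]/(opsys_incl S x) -sum_incl addrAC subrr add0r.
(* The bounds on [r] come from [r 1 = theta 1 = y^* y] and [(1 - r) 1 = omega 1 = z^* z]. *)
have r0 : 0 <= r by apply: (scalar_starM_ge0 (y := y) primA); rewrite -yE.
have r1 : 0 <= 1 - r by apply: (scalar_starM_ge0 (y := z) primA); rewrite -zE omegaE.
by exists r; split=> //; rewrite r0 -subr_ge0.
Qed.
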